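(* Let $p$ be a prime and let $r_1,r_2,r_3$ be integers with $0\le r_3\le r_2\le r_1<p-r_2-r_3$. For each $i$ let $W_i$ denote $V_{r_1+r_2+r_3-2i}$. Then the following isomorphisms of $\mathrm{SL}_2(\mathbb F_p)$-representations hold, where $mW$ denotes the direct sum of $m$ copies of $W$ and empty direct sums are zero. (1) If $r_1\ge r_2+r_3$, then $$V_{r_1}\otimes V_{r_2}\otimes V_{r_3}\cong \bigoplus_{i=0}^{r_3}(i+1)W_i\ \oplus\bigoplus_{i=r_3+1}^{r_2}(r_3+1)W_i\ \oplus\bigoplus_{i=r_2+1}^{r_2+r_3}(r_3+r_2+1-i)W_i.$$ (2) If $r_1<r_2+r_3$, then $$V_{r_1}\otimes V_{r_2}\otimes V_{r_3}\cong \bigoplus_{i=0}^{r_3}(i+1)W_i\ \oplus\bigoplus_{i=r_3+1}^{r_2}(r_3+1)W_i\ \oplus\bigoplus_{i=r_2+1}^{r_1}(r_3+r_2+1-i)W_i\ \oplus\bigoplus_{i=r_1+1}^{\left\lfloor\frac{r_1+r_2+r_3}{2}\right\rfloor}(r_1+r_2+r_3-2i+1)W_i.$$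
   Context: All representations are over a fixed algebraic closure $\overline{\mathbb F}_p$ of $\mathbb F_p$. For $r\ge 0$, $V_r=\mathrm{Sym}^r(\overline{\mathbb F}_p^2)$ is the $(r+1)$-dimensional space of homogeneous polynomials of degree $r$ in two variables $x,y$ over $\overline{\mathbb F}_p$, with $\begin{pmatrix}a&b\\c&d\end{pmatrix}\cdot P(x,y)=P(ax+cy,bx+dy)$, here regarded as a representation of $\mathrm{SL}_2(\mathbb F_p)$; tensor products carry the diagonal action. *)

(* Defs.v *)
From HB Require Import structures.
From mathcomp Require Import all_boot all_algebra fingroup.
From mathcomp Require Import mxrepresentation character.
From mathcomp Require Import mpoly.

Set Implicit Arguments.
Unset Strict Implicit.
Unset Printing Implicit Defensive.

Import GRing.Theory.
Local Open Scope ring_scope.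

(* MathComp has the general linear group but not the special linear one. *)
Definition SL2 (p : nat) : {set {'GL_2(p)}} := [set g | \det (GLval g) == 1].

Lemma SL2_group_set p : group_set (SL2 p).
Proof.
apply/group_setP; split=> [|g h]; rewrite !inE /= ?det1 // => /eqP g1 /eqP h1.
by rewrite det_mulmx g1 h1 mulr1.
Qed.

Canonical SL2_group p := Group (SL2_group_set p).

Section SymmetricPower.

Variable F : fieldType.
Implicit Types (M N : 'M[F]_2) (P : {mpoly F[2]}).

(* The variables x, y are 'X_0, 'X_1, and M = [[a, b]; [c, d]] sends P(x, y)  *)
(* to P(a x + c y, b x + d y).                                                *)
Definition lin_subst M : 2.-tuple {mpoly F[2]} :=
  [tuple M 0 0 *: 'X_0 + M 1 0 *: 'X_1; M 0 1 *: 'X_0 + M 1 1 *: 'X_1].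

Definition sym_act M P : {mpoly F[2]} := P \mPo lin_subst M.

(* The exponent of x^(r - j) y^j.                                             *)
Definition monom2 r (j : 'I_r.+1) : 'X_{1..2} :=
  [multinom [tuple (r - j)%N; val j]].

Definition coord2 r P : 'cV[F]_r.+1 := \col_i P@_(monom2 i).

(* The matrix of sym_act M on V_r in the basis x^r, x^(r-1) y, ..., y^r,      *)
(* acting on the left on columns of coordinates (lemma sym_mx_coord), so that *)
(* M |-> sym_mx r M is multiplicative.                                        *)
Definition sym_mx r M : 'M[F]_r.+1 :=
  \matrix_(i, j) (sym_act M 'X_[monom2 j])@_(monom2 i).

Lemma monom2E0 r (j : 'I_r.+1) : monom2 j 0 = (r - j)%N.
Proof. by rewrite multinomE. Qed.

Lemma monom2E1 r (j : 'I_r.+1) : monom2 j 1 = j.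
Proof. by rewrite multinomE. Qed.

Lemma mdeg2 (m : 'X_{1..2}) : mdeg m = (m 0%R + m 1%R)%N.
Proof.
rewrite mdegE !big_ord_recl big_ord0 addn0.
by congr (m _ + m _)%N; apply: val_inj.
Qed.

Lemma monom2_deg r (j : 'I_r.+1) : mdeg (monom2 j) = r.
Proof. by rewrite mdeg2 monom2E0 monom2E1 subnK // -ltnS. Qed.

Lemma monom2_inj r : injective (@monom2 r).
Proof. by move=> i j e; apply: val_inj; rewrite /= -!monom2E1 e. Qed.

Lemma monom2P r (m : 'X_{1..2}) :
  mdeg m = r -> exists j : 'I_r.+1, m = monom2 j.
Proof.
rewrite mdeg2 => mr.
have lt1 : (m 1%R < r.+1)%N by rewrite ltnS -mr leq_addl.
exists (Ordinal lt1); apply/mnmP => i.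
case: i => [[|[|//]]] lti.
  rewrite (_ : Ordinal lti = 0) ?monom2E0 /= -?mr ?addnK //; exact: val_inj.
rewrite (_ : Ordinal lti = 1) ?monom2E1 //; exact: val_inj.
Qed.

Lemma coord2K r P : P \is r.-homog ->
  P = \sum_j coord2 r P j 0 *: 'X_[monom2 j].
Proof.
move=> homP; apply/mpolyP => m; rewrite linear_sum /=.
have [/eqP/monom2P[k ->]|mr] := boolP (mdeg m == r).
  rewrite (bigD1 k) //= mcoeffZ mcoeffX eqxx mulr1 mxE big1 ?addr0 // => j jk.
  by rewrite mcoeffZ mcoeffX (inj_eq (@monom2_inj r)) (negbTE jk) mulr0.
rewrite (dhomog_nemf_coeff homP mr) big1 // => j _.
rewrite mcoeffZ mcoeffX; case: eqP => [jm|_]; last by rewrite mulr0.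
by rewrite -jm monom2_deg eqxx in mr.
Qed.

Lemma lin_substE M i : tnth (lin_subst M) i = \sum_k M k i *: 'X_k.
Proof.
rewrite !big_ord_recl big_ord0 addr0 (_ : lift _ _ = 1); last exact: val_inj.
case: i => [[|[|//]]] lti.
  by rewrite (_ : Ordinal lti = 0) //; apply: val_inj.
by rewrite (_ : Ordinal lti = 1) //; apply: val_inj.
Qed.

Lemma lin_subst_homog M i : tnth (lin_subst M) i \is 1.-homog.
Proof.
rewrite lin_substE rpred_sum // => k _.
by rewrite rpredZ // dhomogX; apply/eqP/mdeg1.
Qed.

Lemma sym_act_homog r M P : P \is r.-homog -> sym_act M P \is r.-homog.
Proof.
move=> homP; rewrite /sym_act (coord2K homP) linear_sum rpred_sum // => j _.
rewrite linearZ rpredZ //= comp_mpolyX.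
move: (monom2 j) (monom2_deg j) => m <-; rewrite mdeg2 -[m 0]mul1n -[m 1]mul1n.
rewrite !big_ord_recl big_ord0 mulr1 /=.
rewrite (_ : lift _ _ = 1); last exact: val_inj.
by apply: dhomogM; apply: dhomogMn; apply: lin_subst_homog.
Qed.

Lemma sym_act1 P : sym_act 1%:M P = P.
Proof.
rewrite /sym_act -[RHS]comp_mpoly_id; congr (_ \mPo _); apply: eq_from_tnth => i.
rewrite tnth_mktuple lin_substE (bigD1 i) //= mxE eqxx scale1r big1 ?addr0 //.
by move=> k /negbTE ki; rewrite mxE ki scale0r.
Qed.

Lemma sym_actM M N P : sym_act (M *m N) P = sym_act M (sym_act N P).
Proof.
rewrite /sym_act [P \mPo lin_subst N]comp_mpolyEX [LHS]comp_mpolyEX linear_sum.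
apply: eq_bigr => m _; rewrite linearZ /=; congr (_ *: _).
rewrite !comp_mpolyX rmorph_prod /=; apply: eq_bigr => i _.
rewrite rmorphXn /=; congr (_ ^+ _).
rewrite !lin_substE linear_sum /=.
under [RHS]eq_bigr => k _.
  rewrite linearZ /= comp_mpolyXU -tnth_nth lin_substE scaler_sumr.
  over.
rewrite exchange_big; apply: eq_bigr => k _; rewrite mxE scaler_suml.
by apply: eq_bigr => l _; rewrite scalerA mulrC.
Qed.

Lemma sym_mx_coord r M P : P \is r.-homog ->
  coord2 r (sym_act M P) = sym_mx r M *m coord2 r P.
Proof.
move=> homP; rewrite {1}/sym_act {1}(coord2K homP) linear_sum.
apply/colP => i; rewrite !mxE linear_sum /=; apply: eq_bigr => j _.
by rewrite linearZ mcoeffZ !mxE mulrC.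
Qed.

Lemma sym_mx1 r : sym_mx r 1%:M = 1%:M.
Proof.
apply/matrixP => i j; rewrite !mxE sym_act1 mcoeffX.
by rewrite (inj_eq (@monom2_inj r)) eq_sym.
Qed.

Lemma sym_mxM r M N : sym_mx r (M *m N) = sym_mx r M *m sym_mx r N.
Proof.
apply/matrixP => i j; have hX : 'X_[F, monom2 j] \is r.-homog.
  by rewrite dhomogX; apply/eqP/monom2_deg.
have /colP/(_ i) := sym_mx_coord M (sym_act_homog N hX).
by rewrite -sym_actM !mxE => ->; apply: eq_bigr => k _; rewrite !mxE.
Qed.

End SymmetricPower.

Section Representations.

Variables (p : nat) (F : fieldType) (iota : {rmorphism 'F_p -> F}).

Lemma sym_mx_repr r :
  mx_repr (SL2 p) (fun g => sym_mx r (map_mx iota (GLval g))).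
Proof.
split=> [|g h _ _]; first by rewrite GL_1E map_mx1 sym_mx1.
by rewrite GL_ME map_mxM sym_mxM.
Qed.

(* V_r as a representation of SL_2(F_p) over F, through iota : F_p -> F.      *)
Definition sym_repr r : representation F (SL2 p) :=
  Representation (MxRepresentation (sym_mx_repr r)).

End Representations.

Definition tensor_grepr (F : fieldType) (gT : finGroupType) (G : {group gT})
    (V W : representation F G) : representation F G :=
  Representation (prod_repr V W).

Declare Scope grepr_scope.
Delimit Scope grepr_scope with grepr.
Bind Scope grepr_scope with representation.

Notation "V \otimes W" := (tensor_grepr V W)
  (at level 40, left associativity) : grepr_scope.
Notation "V \oplus W" := (dadd_grepr V W)
  (at level 50, left associativity) : grepr_scope.
Notation "m \copies W" := (muln_grepr W m)
  (at level 35, W at level 34) : grepr_scope.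
Notation "\bigoplus_ ( m <= i < n ) V" :=
  (\big[@dadd_grepr _ _ _ / grepr0]_(m <= i < n) V%grepr)
  (at level 41, V at level 41, i, m, n at level 50) : grepr_scope.
Notation "V \cong W" := (mx_rsim V%grepr W%grepr) (at level 70) : type_scope.

(* Main.v *)
Require Import Defs.
From mathcomp Require Import all_boot all_algebra fingroup.
From mathcomp Require Import mxrepresentation character.
From mathcomp Require Import mpoly zify ring.

(* For a + b < p there is an isomorphism                                      *)
(*   V_a (x) V_b ~ V_(a+b) (+) V_(a-1) (x) V_(b-1)                            *)
(* whose components are the multiplication P (x) Q |-> P Q and the            *)
(* transvectant d/dx d/dv - d/dy d/du, where V_a is in the variables x, y and *)
(* V_b in u, v. The dimensions agree, and it is injective: if the transvectant*)
(* kills a tensor, its coefficient at x^(a-i) y^i u^(b-j) v^j is              *)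
(* 'C(a, i) 'C(b, j) c_(i+j), and then by Vandermonde the product has         *)
(* coefficients 'C(a + b, k) c_k, whose binomials are invertible modulo p.    *)
(* Iterating gives the Clebsch-Gordan decomposition of V_a (x) V_b; applying  *)
(* it twice, W_k occurs in the triple product once for each pair i + j = k    *)
(* with j <= r2 and i <= min(r1 + r2 - 2j, r3).                               *)

(** Equivariance of the two components is [mult_mx_sym], because substitution respects products, and
    [transvectant_sym], because (d/dx, d/dy) transforms linearly under the matrix and an alternating
    expression in two such pairs is scaled by the determinant, here 1. Injectivity is
    [mult_transvectant_inj]. A dimension count turns this into the recursion [sym_tensor_rec_rsim],
    and induction gives [clebsch_gordan]. Used twice, it writes the triple product as a sum of W_k
    over an explicit list of indices k ([sym_tensor3_rsim]). The right-hand sides are sums of the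
    same kind, so by [big_dadd_perm] only multiplicities have to be compared. [count_tensor3] counts
    the j with k - r3 <= j <= min(r2, k, r1 + r2 - k); the ranges of the theorem record which of
    these bounds, together with 0 <= j, are active. *)

Set Implicit Arguments.
Unset Strict Implicit.
Unset Printing Implicit Defensive.

Import GRing.Theory.
Local Open Scope ring_scope.

(** * The action on V_r in one variable, and the chain rule for partial derivatives *)

Section SymMatrix.

Variable F : fieldType.
Implicit Types (M : 'M[F]_2) (P : {mpoly F[2]}).

(* Sets x = 1 and y = 'X.                                                     *)
Definition dehomog P : {poly F} := mmap polyC (fun i : 'I_2 => 'X^i) P.

Lemma dehomog_monom r (j : 'I_r.+1) : dehomog 'X_[monom2 j] = 'X^j.
Proof.
rewrite /dehomog mmapX /mmap1 !big_ord_recl big_ord0 mulr1 expr1n mul1r.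
rewrite (_ : lift _ _ = 1); last exact: val_inj.
by rewrite monom2E1 expr1.
Qed.

Lemma dehomog_coef r P (i : 'I_r.+1) : P \is r.-homog ->
  P@_(monom2 i) = (dehomog P)`_i.
Proof.
move=> homP; rewrite [in RHS](coord2K homP) /dehomog raddf_sum coef_sum.
rewrite (bigD1 i) //= -mul_mpolyC rmorphM /= mmapC.
rewrite -[mmap _ _ _]/(dehomog _) dehomog_monom coefCM coefXn eqxx mulr1 mxE.
rewrite big1 ?addr0 // => j ji; rewrite -mul_mpolyC rmorphM /= mmapC.
rewrite -[mmap _ _ 'X_[_]]/(dehomog _) dehomog_monom coefCM coefXn.
by rewrite (inj_eq val_inj) eq_sym (negbTE ji) mulr0.
Qed.

(** The dehomogenized image of the variable ['X_k] under [M]. *)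
Definition lin_poly M k : {poly F} := (M 0 k)%:P + M 1 k *: 'X.

(** The dehomogenized image of x^(r-j) y^j; its coefficients form column [j] of [sym_mx r M]. *)
Definition sym_poly r M j : {poly F} :=
  lin_poly M 0 ^+ (r - j) * lin_poly M 1 ^+ j.

Lemma sym_mxE r M i j : sym_mx r M i j = (sym_poly r M j)`_i.
Proof.
have hX : 'X_[F, monom2 j] \is r.-homog.
  by rewrite dhomogX; apply/eqP/monom2_deg.
rewrite mxE (dehomog_coef _ (sym_act_homog M hX)) /sym_act comp_mpolyX.
congr (_`_i); rewrite /dehomog rmorph_prod /sym_poly.
have lin k : mmap polyC (fun i : 'I_2 => 'X^i) (tnth (lin_subst M) k)
  = lin_poly M k.
  rewrite lin_substE !big_ord_recl big_ord0 addr0 raddfD /=.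
  rewrite -!mul_mpolyC !rmorphM /= !mmapC !mmapX /lin_poly.
  rewrite (_ : lift _ _ = 1) -?mul_polyC ?mmap1U ?expr1 ?mulr1 //.
  exact: val_inj.
under eq_bigr => k _ do rewrite rmorphXn /= lin.
rewrite !big_ord_recl big_ord0 mulr1 monom2E0.
rewrite (_ : lift _ _ = 1) ?monom2E1 //; exact: val_inj.
Qed.

(* d/dx and d/dy from V_r to V_(r-1).                                         *)
Definition partial_x r : 'M[F]_(r, r.+1) :=
  \matrix_(k, i) ((r - i)%:R *+ (k == i :> nat)).
Definition partial_y r : 'M[F]_(r, r.+1) :=
  \matrix_(k, i) (i%:R *+ (k.+1 == i :> nat)).

Lemma mul_partial_x r m (A : 'M_(r.+1, m)) k j :
  (partial_x r *m A) k j = (r - k)%:R * A (widen_ord (leqnSn r) k) j.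
Proof.
rewrite mxE (bigD1 (widen_ord (leqnSn r) k)) //= mxE eqxx big1 ?addr0 //.
move=> i ik; rewrite mxE (_ : (k == i :> nat) = false) ?mul0r //.
by apply/negbTE; apply: contra ik => /eqP e; apply/eqP/val_inj.
Qed.

Lemma mul_partial_y r m (A : 'M_(r.+1, m)) k j :
  (partial_y r *m A) k j = k.+1%:R * A (lift ord0 k) j.
Proof.
rewrite mxE (bigD1 (lift ord0 k)) //= mxE eqxx big1 ?addr0 //.
move=> i ik; rewrite mxE (_ : (k.+1 == i :> nat) = false) ?mul0r //.
by apply/negbTE; apply: contra ik => /eqP e; apply/eqP/val_inj.
Qed.

Lemma sym_mul_partial_x r M i j :
  (sym_mx r M *m partial_x r.+1) i j
    = (r.+1 - j)%:R * (sym_poly r M j)`_i.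
Proof.
rewrite mxE; case: (ltnP j r.+1) => [jr|rj].
  rewrite (bigD1 (Ordinal jr)) //= sym_mxE mxE eqxx mulrC big1 ?addr0 //.
  move=> k kj; rewrite sym_mxE mxE (_ : (k == j :> nat) = false) ?mulr0 //.
  by apply/negbTE; apply: contra kj => /eqP e; apply/eqP/val_inj.
rewrite (_ : (r.+1 - j = 0)%N) ?mul0r; last by apply/eqP; rewrite subn_eq0.
rewrite big1 // => k _; rewrite sym_mxE mxE.
rewrite (_ : (k == j :> nat) = false) ?mulr0 //.
by apply/negbTE; rewrite neq_ltn (leq_trans (ltn_ord k)).
Qed.

Lemma sym_mul_partial_y r M i j :
  (sym_mx r M *m partial_y r.+1) i j = j%:R * (sym_poly r M j.-1)`_i.
Proof.
rewrite mxE; case: j => [[|j] lt_j] /=.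
  by rewrite mul0r big1 // => k _; rewrite sym_mxE mxE mulr0.
have def_j : Ordinal lt_j = lift ord0 (Ordinal (lt_j : (j < r.+1)%N)).
  exact: val_inj.
rewrite (bigD1 (Ordinal (lt_j : (j < r.+1)%N))) //= sym_mxE mxE.
rewrite def_j lift0 eqxx.
rewrite mulrC big1 ?addr0 // => k kj; rewrite sym_mxE mxE lift0 eqSS.
rewrite (_ : (k == _ :> nat) = false) ?mulr0 //.
by apply/negbTE; apply: contra kj => /eqP e; apply/eqP/val_inj.
Qed.

Lemma deriv_lin_poly M k : (lin_poly M k)^`() = (M 1 k)%:P.
Proof. by rewrite /lin_poly derivD derivC add0r derivZ derivX alg_polyC. Qed.

(** The product rule. At j = 0 and j = r + 1 a truncated exponent appears on the right, but its
    coefficient vanishes. *)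
Lemma sym_poly_deriv r M j : (j <= r.+1)%N ->
  (sym_poly r.+1 M j)^`()
    = (M 1 0 * (r.+1 - j)%:R)%:P * sym_poly r M j
      + (M 1 1 * j%:R)%:P * sym_poly r M j.-1.
Proof.
move=> jr; rewrite /sym_poly derivM !deriv_exp !deriv_lin_poly.
have -> : ((r.+1 - j).-1 = r - j)%N by lia.
rewrite !mulr_natr !polyCMn !mulrnAl !mulrnAr.
congr (_ *+ _ + _); first by rewrite -mulrA.
case: j jr => [|j] jr /=; first by rewrite !mulr0n.
by rewrite subSS mulrCA.
Qed.

(** Chain rule: d/dy of P(ax + cy, bx + dy) is c P_x + d P_y at the same point. *)
Lemma partial_y_sym r M :
  partial_y r.+1 *m sym_mx r.+1 M
    = sym_mx r M *m (M 1 0 *: partial_x r.+1 + M 1 1 *: partial_y r.+1).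
Proof.
apply/matrixP => i j; rewrite mul_partial_y mulmxDr -!scalemxAr.
rewrite [RHS]mxE [in RHS]mxE [(_ *: (_ *m _)) i j]mxE.
rewrite sym_mul_partial_x sym_mul_partial_y sym_mxE lift0.
have jr : (j <= r.+1)%N by rewrite -ltnS.
have /(congr1 (fun q : {poly F} => q`_i)) := sym_poly_deriv M jr.
rewrite coef_deriv coefD !coefCM !mulrA => <-.
exact: mulr_natl.
Qed.

(* Dehomogenized form of Euler's identity x dP/dx = (r + 1) P - y dP/dy.      *)
Lemma sym_poly_euler r M j : (j <= r.+1)%N ->
  (sym_poly r.+1 M j) *+ r.+1 - 'X * (sym_poly r.+1 M j)^`()
    = (M 0 0 * (r.+1 - j)%:R)%:P * sym_poly r M j
      + (M 0 1 * j%:R)%:P * sym_poly r M j.-1.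
Proof.
move=> jr; rewrite sym_poly_deriv //.
(* Split r + 1 as (r + 1 - j) + j and extract one linear factor from each part; subtracting the
   derivative term then leaves the constant coefficients of these factors. *)
have -> : sym_poly r.+1 M j *+ r.+1
  = (r.+1 - j)%:R%:P * (lin_poly M 0 * sym_poly r M j)
    + j%:R%:P * (lin_poly M 1 * sym_poly r M j.-1).
  rewrite -[X in _ *+ X](subnK jr) mulrnDr !polyC_natr !mulr_natl.
  congr (_ + _).
    case: (ltnP j r.+1) => [|rj]; last first.
      by rewrite (_ : (r.+1 - j = 0)%N) ?mulr0n //; lia.
    by move=> ?; rewrite /sym_poly subSn // exprS mulrA.
  case: j jr => [|j] jr; first by rewrite !mulr0n.
  by rewrite /sym_poly subSS exprS mulrCA.
by rewrite /lin_poly !polyCM -!mul_polyC; ring.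
Qed.

Lemma partial_x_sym r M :
  partial_x r.+1 *m sym_mx r.+1 M
    = sym_mx r M *m (M 0 0 *: partial_x r.+1 + M 0 1 *: partial_y r.+1).
Proof.
apply/matrixP => i j; rewrite mul_partial_x mulmxDr -!scalemxAr.
rewrite [RHS]mxE [in RHS]mxE [(_ *: (_ *m _)) i j]mxE.
rewrite sym_mul_partial_x sym_mul_partial_y sym_mxE.
have jr : (j <= r.+1)%N by rewrite -ltnS.
have /(congr1 (fun q : {poly F} => q`_i)) := sym_poly_euler M jr.
rewrite coefB coefD !coefCM !mulrA => <-.
rewrite coefMn coefXM coef_deriv natrB 1?ltnW //= mulrBl mulr_natl.
congr (_ - _); first exact: mulr_natl.
by case: (nat_of_ord i).
Qed.

End SymMatrix.

(** * Entries of Kronecker products *)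

Fact pair_ord_subproof m n (i : 'I_m) (j : 'I_n) : (i * n + j < m * n)%N.
Proof.
rewrite (@leq_trans (i.+1 * n)) ?leq_mul2r ?ltn_ord ?orbT //.
by rewrite mulSn addnC ltn_add2r.
Qed.

(* The index of entry (i, j) in the row-major order of tprod.                 *)
Definition pair_ord m n (i : 'I_m) (j : 'I_n) : 'I_(m * n) :=
  Ordinal (pair_ord_subproof i j).

Lemma pair_ord_bij m n :
  bijective (fun ij : 'I_m * 'I_n => pair_ord ij.1 ij.2).
Proof.
apply: inj_card_bij; last by rewrite card_prod !card_ord.
move=> [i j] [k l] /= [e].
have n_gt0 : (0 < n)%N by case: n j {k l e} => [[]|].
congr (_, _); apply: val_inj => /=.
  by have := congr1 (divn^~ n) e; rewrite !divnMDl // !divn_small ?addn0.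
by have := congr1 (modn^~ n) e; rewrite !modnMDl !modn_small.
Qed.

Lemma pair_ordP m n (k : 'I_(m * n)) :
  exists i : 'I_m, exists j : 'I_n, k = pair_ord i j.
Proof.
have [f _ fK] := pair_ord_bij m n.
by exists (f k).1, (f k).2; rewrite (fK k).
Qed.

Lemma sum_pair_ord (V : zmodType) m n (f : 'I_(m * n) -> V) :
  \sum_k f k = \sum_i \sum_j f (pair_ord i j).
Proof.
rewrite (reindex _ (onW_bij _ (pair_ord_bij m n))) /=.
by rewrite [RHS]pair_bigA.
Qed.

(** [tprod] and [trow] are built recursively from blocks; this lemma and the next match [pair_ord]
    with that block splitting. *)
Lemma pair_ord0 m n (j : 'I_n) :
  pair_ord (0 : 'I_m.+1) j = lshift (m * n) j :> 'I_(n + m * n).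
Proof. exact: val_inj. Qed.

Lemma pair_ordS m n (i : 'I_m) (j : 'I_n) :
  pair_ord (lift (0 : 'I_m.+1) i) j = rshift n (pair_ord i j) :> 'I_(n + m * n).
Proof. by apply: val_inj; rewrite /= /bump /= mulnDl mul1n addnA. Qed.

Section TensorMatrix.

Variable F : fieldType.

Lemma trow_entry m n q (A : 'rV[F]_m) (B : 'M[F]_(q, n)) l i j :
  trow A B l (pair_ord i j) = A 0 i * B l j.
Proof.
elim: m A i => [|m IHm] A i; first by case: i.
case: (unliftP 0 i) => [k ->|->].
  rewrite pair_ordS /= row_mxEr IHm mxE.
  by congr (A _ _ * _); apply: val_inj.
by rewrite pair_ord0 /= row_mxEl !mxE; congr (A _ _ * _); apply: val_inj.
Qed.

Lemma tprod_entry m1 n1 m2 n2 (A : 'M[F]_(m1, n1)) (B : 'M[F]_(m2, n2))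
    i j k l :
  tprod A B (pair_ord i j) (pair_ord k l) = A i k * B j l.
Proof.
elim: m1 A i => [|m IHm] A i; first by case: i.
case: (unliftP 0 i) => [h ->|->].
  rewrite pair_ordS /= col_mxEd IHm mxE.
  by congr (A _ _ * _); apply: val_inj.
rewrite pair_ord0 /= col_mxEu trow_entry !mxE.
by congr (A _ _ * _); apply: val_inj.
Qed.

Lemma tprodP m1 n1 m2 n2 (X Y : 'M[F]_(m1 * m2, n1 * n2)) :
  (forall i j k l,
    X (pair_ord i j) (pair_ord k l) = Y (pair_ord i j) (pair_ord k l)) ->
  X = Y.
Proof.
move=> eqXY; apply/matrixP => p q.
by have [i [j ->]] := pair_ordP p; have [k [l ->]] := pair_ordP q.
Qed.

Lemma tprod0l m1 n1 m2 n2 (B : 'M[F]_(m2, n2)) :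
  tprod (0 : 'M_(m1, n1)) B = 0.
Proof. by apply: tprodP => *; rewrite tprod_entry !mxE mul0r. Qed.

Lemma det_mx22 (M : 'M[F]_2) : \det M = M 0 0 * M 1 1 - M 0 1 * M 1 0.
Proof.
rewrite (expand_det_row _ 0) !big_ord_recl big_ord0 addr0 /cofactor !det_mx11.
rewrite !mxE /= expr0 mul1r expr1 mulN1r mulrN.
by congr (M _ _ * M _ _ - M _ _ * M _ _); apply: val_inj.
Qed.

(** The 2 x 2 alternating identity behind the invariance of the transvectant: [A0], [A1] and [B0],
    [B1] will be the partial derivatives on the two factors. *)
Lemma tprod_det2 m1 n1 m2 n2 (A0 A1 : 'M[F]_(m1, n1)) (B0 B1 : 'M[F]_(m2, n2))
    (M : 'M[F]_2) :
  let a i := M i 0 *: A0 + M i 1 *: A1 in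
  let b i := M i 0 *: B0 + M i 1 *: B1 in
  tprod (a 0) (b 1) - tprod (a 1) (b 0)
    = \det M *: (tprod A0 B1 - tprod A1 B0).
Proof.
move=> a b; rewrite det_mx22; apply: tprodP => i j k l.
rewrite /a /b !mxE !tprod_entry !mxE; ring.
Qed.

End TensorMatrix.

(** * Multiplication and the transvectant: equivariance and joint injectivity *)

Section Transvectant.

Variable F : fieldType.
Implicit Type M : 'M[F]_2.

(* P (x) Q |-> P Q.                                                           *)
Definition mult_mx a b : 'M[F]_((a + b).+1, a.+1 * b.+1) :=
  \matrix_(k, q) (k == q %/ b.+1 + q %% b.+1 :> nat)%N%:R.

Lemma mult_mx_entry a b k (i : 'I_a.+1) (j : 'I_b.+1) :
  mult_mx a b k (pair_ord i j) = (k == i + j :> nat)%N%:R.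
Proof.
by rewrite mxE /= divnMDl // modnMDl divn_small // modn_small // addn0.
Qed.

Lemma size_sym_poly r M (j : 'I_r.+1) : (size (sym_poly r M j) <= r.+1)%N.
Proof.
have size_lin k n : (size (lin_poly M k ^+ n) <= n.+1)%N.
  apply: leq_trans (size_poly_exp_leq _ _) _; rewrite ltnS -[leqRHS]mul1n.
  rewrite leq_mul2r -subn1 leq_subLR orbC (leq_trans (size_polyD _ _)) //.
  rewrite geq_max (leq_trans (size_polyC_leq1 _)) //=.
  by rewrite (leq_trans (size_scale_leq _ _)) // size_polyX.
apply: leq_trans (size_polyMleq _ _) _.
have := size_lin 0 (r - j)%N; have := size_lin 1 j; have := ltn_ord j.
rewrite /sym_poly; lia.
Qed.

Lemma coefM_sum (p q : {poly F}) m n k :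
  (size p <= m)%N -> (size q <= n)%N ->
  (p * q)`_k = \sum_(i < m) \sum_(j < n) (k == i + j)%N%:R * (p`_i * q`_j).
Proof.
move=> pm qn; rewrite -[in LHS](take_poly_id pm) -[in LHS](take_poly_id qn).
rewrite /take_poly !poly_def big_distrlr coef_sum; apply: eq_bigr => i _.
rewrite coef_sum; apply: eq_bigr => j _ /=.
by rewrite -scalerAl -scalerAr -exprD !coefZ coefXn mulrA mulrC.
Qed.

(** Column (i, j) of both sides lists the coefficients of one product, since
    [sym_poly a M i * sym_poly b M j] is [sym_poly (a + b) M (i + j)]. *)
Lemma mult_mx_sym a b M :
  mult_mx a b *m tprod (sym_mx a M) (sym_mx b M)
    = sym_mx (a + b) M *m mult_mx a b.
Proof.
apply/matrixP => k q; have [i [j ->]] := pair_ordP q.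
have lt_ij : (i + j < (a + b).+1)%N by rewrite ltnS leq_add // -ltnS.
transitivity ((sym_poly a M i * sym_poly b M j)`_k).
  rewrite (coefM_sum _ (size_sym_poly M i) (size_sym_poly M j)).
  rewrite mxE sum_pair_ord; apply: eq_bigr => x _; apply: eq_bigr => y _.
  by rewrite mult_mx_entry tprod_entry !sym_mxE.
rewrite mxE (bigD1 (Ordinal lt_ij)) //= mult_mx_entry eqxx mulr1 big1.
  rewrite addr0 sym_mxE; have := ltn_ord i; have := ltn_ord j.
  rewrite !ltnS => jb ia; rewrite /sym_poly /=.
  rewrite (_ : a + b - (i + j) = (a - i) + (b - j))%N; last lia.
  by rewrite !exprD mulrACA.
move=> l /negbTE li; rewrite mult_mx_entry.
by rewrite (_ : (l == _ :> nat) = false) ?mulr0.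
Qed.

(* d/dx d/dv - d/dy d/du, for V_a in the variables x, y and V_b in u, v.      *)
Definition transvectant a b : 'M[F]_(a * b, a.+1 * b.+1) :=
  tprod (partial_x F a) (partial_y F b) - tprod (partial_y F a) (partial_x F b).

Lemma transvectant_sym a b M : \det M = 1 ->
  transvectant a.+1 b.+1 *m tprod (sym_mx a.+1 M) (sym_mx b.+1 M)
    = tprod (sym_mx a M) (sym_mx b M) *m transvectant a.+1 b.+1.
Proof.
move=> detM; rewrite {1}/transvectant mulmxBl -!tprodE.
rewrite !partial_x_sym !partial_y_sym !tprodE -mulmxBr.
by rewrite tprod_det2 detM scale1r.
Qed.

(** Reading [v] as a matrix V, the Kronecker product acts by A V B^T, so each partial derivative can
    be evaluated on its own side. *)
Lemma tprod_mul_col m1 n1 m2 n2 (A : 'M[F]_(m1, n1)) (B : 'M[F]_(m2, n2))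
    (v : 'cV_(n1 * n2)) i j :
  (tprod A B *m v) (pair_ord i j) 0
    = (A *m (B *m (\matrix_(k, l) v (pair_ord k l) 0)^T)^T) i j.
Proof.
rewrite !mxE sum_pair_ord; apply: eq_bigr => k _; rewrite !mxE mulr_sumr.
by apply: eq_bigr => l _; rewrite tprod_entry !mxE mulrA.
Qed.

Lemma transvectant_col a b (v : 'cV_(a.+1 * b.+1)) i j :
  (transvectant a b *m v) (pair_ord i j) 0
    = (a - i)%:R * j.+1%:R * v (pair_ord (widen_ord (leqnSn a) i) (lift 0 j)) 0
      - i.+1%:R * (b - j)%:R
        * v (pair_ord (lift 0 i) (widen_ord (leqnSn b) j)) 0.
Proof.
rewrite /transvectant mulmxBl [LHS]mxE [X in _ + X]mxE !tprod_mul_col.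
have trE m n (A : 'M[F]_(m, n)) k l : A^T k l = A l k by rewrite mxE.
rewrite mul_partial_x mul_partial_y !trE mul_partial_x mul_partial_y.
by rewrite !mxE !mulrA.
Qed.

Lemma natr_neq0_dvd m n : (m %| n)%N -> n%:R != 0 :> F -> m%:R != 0 :> F.
Proof.
by case/dvdnP => q ->; apply: contraNneq => m0; rewrite natrM m0 mulr0.
Qed.

Lemma natr_bin_neq0 m n k : (k <= n)%N -> (n <= m)%N ->
  m`!%:R != 0 :> F -> 'C(n, k)%:R != 0 :> F.
Proof.
move=> kn nm; apply: natr_neq0_dvd.
apply: (@dvdn_trans n`!); first by rewrite -(bin_fact kn) dvdn_mulr.
by rewrite -(bin_fact nm) dvdn_mull // dvdn_mulr.
Qed.

Lemma coef_X1_exp n k : (('X + 1 : {poly F}) ^+ n)`_k = 'C(n, k)%:R.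
Proof.
rewrite addrC exprDn coef_sum; case: (ltnP k n.+1) => [kn|nk].
  rewrite (bigD1 (Ordinal kn)) //= big1 => [|i /negbTE ik].
    by rewrite expr1n mul1r coefMn coefXn eqxx addr0.
  rewrite expr1n mul1r coefMn coefXn (_ : (k == i :> nat) = false) ?mul0rn //.
  by rewrite eq_sym; apply: contraFF ik => /eqP e; apply/eqP/val_inj.
rewrite bin_small // big1 // => i _; rewrite expr1n mul1r coefMn coefXn.
by rewrite gtn_eqF ?mul0rn // (leq_trans (ltn_ord i)).
Qed.

Lemma size_X1_exp n : size (('X + 1 : {poly F}) ^+ n) = n.+1.
Proof.
have -> : 'X + 1 = 'X - (- 1)%:P :> {poly F} by rewrite polyCN opprK.
exact: size_exp_XsubC.
Qed.

(* The first hypothesis on f, the vanishing of the transvectant, makes        *)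
(* f i j / ('C(a, i) * 'C(b, j)) a function c of i + j only; by Vandermonde   *)
(* the second one then says that c k * 'C(a + b, k) = 0.                      *)
Lemma mult_transvectant_ker0 a b (f : nat -> nat -> F) :
  (a + b)`!%:R != 0 :> F ->
  (forall i j, (i < a)%N -> (j < b)%N ->
    (a - i)%:R * j.+1%:R * f i j.+1 = i.+1%:R * (b - j)%:R * f i.+1 j) ->
  (forall k, (k <= a + b)%N ->
    \sum_(i < a.+1) \sum_(j < b.+1) (k == i + j)%N%:R * f i j = 0) ->
  forall i j, (i <= a)%N -> (j <= b)%N -> f i j = 0.
Proof.
move=> fact_neq0 rel_f sum_f.
have Ca i : (i <= a)%N -> 'C(a, i)%:R != 0 :> F.
  by move=> ia; apply: natr_bin_neq0 fact_neq0; rewrite ?leq_addr.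
have Cb j : (j <= b)%N -> 'C(b, j)%:R != 0 :> F.
  by move=> jb; apply: natr_bin_neq0 fact_neq0; rewrite ?leq_addl.
have nat_neq0 n : (n < a + b)%N -> n.+1%:R != 0 :> F.
  by move=> nab; apply: natr_neq0_dvd fact_neq0; rewrite dvdn_fact.
pose g i j := f i j / ('C(a, i)%:R * 'C(b, j)%:R).
have fE i j : (i <= a)%N -> (j <= b)%N ->
    f i j = 'C(a, i)%:R * 'C(b, j)%:R * g i j.
  by move=> ia jb; rewrite mulrC divfK // mulf_neq0 ?Ca ?Cb.
have shift_g i j : (i < a)%N -> (j < b)%N -> g i j.+1 = g i.+1 j.
  move=> ia jb; have := rel_f i j ia jb.
  rewrite (fE i j.+1 (ltnW ia) jb) (fE i.+1 j ia (ltnW jb)) => e.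
  have ea : (i.+1%:R * 'C(a, i.+1)%:R = (a - i)%:R * 'C(a, i)%:R :> F).
    by rewrite -!natrM mul_bin_left.
  have eb : (j.+1%:R * 'C(b, j.+1)%:R = (b - j)%:R * 'C(b, j)%:R :> F).
    by rewrite -!natrM mul_bin_left.
  (* By [ea] and [eb], this is the common coefficient of the two values of [g] in the relation [e],
     so it can be cancelled. *)
  have u0 : ((a - i)%:R * 'C(a, i)%:R) * ((b - j)%:R * 'C(b, j)%:R) != 0 :> F.
    rewrite -ea -eb !mulf_neq0 ?Ca ?Cb // nat_neq0 //.
      by rewrite ltn_addr.
    by rewrite ltn_addl.
  apply: (mulfI u0); rewrite -{1}eb -{2}ea.
  by apply: etrans (etrans e _); ring.
(* The representative of the antidiagonal i + j = k is its point with largest i <= a; [shift_g]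
   moves every other point towards it. *)
pose c k := g (minn k a) (k - minn k a)%N.
have gE i j : (i <= a)%N -> (j <= b)%N -> g i j = c (i + j)%N.
  elim: j i => [|j IHj] i ia jb.
    by rewrite /c addn0 (minn_idPl ia) subnn.
  move: ia; rewrite leq_eqVlt => /predU1P[-> | ia].
    by rewrite /c (minn_idPr (leq_addr _ _)) addKn.
  by rewrite shift_g // (IHj _ ia (ltnW jb)) addSnnS.
have c0 k : (k <= a + b)%N -> c k = 0.
  move=> kab; have := sum_f k kab.
  have -> : \sum_(i < a.+1) \sum_(j < b.+1) (k == i + j)%N%:R * f i j
     = 'C(a + b, k)%:R * c k.
    (* Vandermonde, by comparing coefficients in (X + 1)^(a+b) = (X + 1)^a (X + 1)^b. *)
    rewrite -coef_X1_exp exprD (@coefM_sum _ _ a.+1 b.+1).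
    - rewrite mulr_suml; apply: eq_bigr => i _; rewrite mulr_suml.
      apply: eq_bigr => j _; rewrite !coef_X1_exp.
      case: eqP => [->|_]; last by rewrite !mul0r.
      by rewrite !mul1r fE ?gE // -ltnS.
    - by rewrite size_X1_exp.
    - by rewrite size_X1_exp.
  move/eqP; rewrite mulf_eq0.
  by rewrite (negbTE (natr_bin_neq0 kab _ fact_neq0)) // => /eqP.
move=> i j ia jb; rewrite fE // gE // c0 ?mulr0 //; exact: leq_add.
Qed.

Lemma mult_transvectant_inj a b (v : 'cV[F]_(a.+1 * b.+1)) :
  (a + b)`!%:R != 0 :> F ->
  mult_mx a b *m v = 0 -> transvectant a b *m v = 0 -> v = 0.
Proof.
move=> fact_neq0 mult0 trans0.
pose f i j : F := v (pair_ord (inord i) (inord j)) 0.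
have fE (i : 'I_a.+1) (j : 'I_b.+1) : v (pair_ord i j) 0 = f i j.
  by rewrite /f !inord_val.
apply/colP => q; have [i [j ->]] := pair_ordP q; rewrite fE mxE.
apply: (mult_transvectant_ker0 fact_neq0); rewrite -1?ltnS //.
  move=> k l ka lb; apply/eqP; rewrite -subr_eq0; apply/eqP.
  have /colP/(_ (pair_ord (Ordinal ka) (Ordinal lb))) := trans0.
  by rewrite transvectant_col !fE !mxE /=.
move=> k kab.
have /colP/(_ (Ordinal (kab : (k < (a + b).+1)%N))) := mult0.
rewrite !mxE sum_pair_ord => e; rewrite -[RHS]e; apply: eq_bigr => x _.
by apply: eq_bigr => y _; rewrite mult_mx_entry fE.
Qed.

End Transvectant.

(** * Direct sums and tensor products up to isomorphism *)

Section Similarity.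

Variables (F : fieldType) (gT : finGroupType) (G : {group gT}).
Implicit Types U V W : representation F G.

Lemma mx_rsim_rinv n1 n2 (rG1 : mx_representation F G n1)
    (rG2 : mx_representation F G n2) (B : 'M_(n1, n2)) (C : 'M_(n2, n1)) :
  n1 = n2 -> B *m C = 1%:M ->
  {in G, forall x, rG1 x *m B = B *m rG2 x} -> mx_rsim rG1 rG2.
Proof. by move=> eq_n BC hB; exists B => //; apply/row_freeP; exists C. Qed.

(** [mx_rsim] intertwines actions on rows, whereas [B] here acts on columns. So [B] is a similarity
    from [rG2] to [rG1], invertible because it is square and injective. *)
Lemma mx_rsim_inj n1 n2 (rG1 : mx_representation F G n1)
    (rG2 : mx_representation F G n2) (B : 'M_(n2, n1)) :
  n1 = n2 -> (forall v : 'cV_n1, B *m v = 0 -> v = 0) ->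
  {in G, forall x, B *m rG1 x = rG2 x *m B} -> mx_rsim rG1 rG2.
Proof.
move=> eq_n; case: n2 / eq_n rG2 B => rG2 B injB hB.
apply/mx_rsim_sym; exists B => // [|x Gx]; last by rewrite hB.
rewrite row_free_unit -unitmx_tr -row_free_unit -kermx_eq0.
apply/eqP/row_matrixP => i.
rewrite row0 -[LHS]trmxK [(row _ _)^T]injB ?trmx0 //.
by apply: trmx_inj; rewrite trmx_mul trmxK -row_mul mulmx_ker row0 trmx0.
Qed.

Lemma dadd_rsim U1 U2 V1 V2 :
  U1 \cong U2 -> V1 \cong V2 -> U1 \oplus V1 \cong U2 \oplus V2.
Proof.
case=> B eB /row_freeP[B' BB'] hB [C eC /row_freeP[C' CC'] hC].
apply: (@mx_rsim_rinv _ _ _ _ (block_mx B 0 0 C) (block_mx B' 0 0 C')) => /=.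
- by rewrite eB eC.
- by rewrite mulmx_block !mulmx0 !mul0mx !addr0 !add0r BB' CC' -scalar_mx_block.
move=> x Gx; rewrite !mulmx_block !mulmx0 !mul0mx !addr0 !add0r.
by rewrite hB // hC.
Qed.

Lemma tensor_rsim U1 U2 V1 V2 :
  U1 \cong U2 -> V1 \cong V2 -> U1 \otimes V1 \cong U2 \otimes V2.
Proof.
case=> B eB /row_freeP[B' BB'] hB [C eC /row_freeP[C' CC'] hC].
apply: (@mx_rsim_rinv _ _ _ _ (tprod B C) (tprod B' C')) => /=.
- by rewrite eB eC.
- by rewrite -tprodE BB' CC' tprod1.
by move=> x Gx; rewrite -!tprodE hB // hC.
Qed.

Lemma dadd_rsimC U V : U \oplus V \cong V \oplus U.
Proof.
apply: (@mx_rsim_rinv _ _ _ _ (block_mx 0 1%:M 1%:M 0)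
                              (block_mx 0 1%:M 1%:M 0)) => /=.
- exact: addnC.
- by rewrite mulmx_block !mulmx0 !mul0mx !addr0 !add0r !mulmx1 -scalar_mx_block.
move=> x Gx; rewrite !mulmx_block !mulmx0 !mul0mx !addr0 !add0r.
by rewrite !mulmx1 !mul1mx.
Qed.

Lemma dadd_rsimA U V W : U \oplus (V \oplus W) \cong U \oplus V \oplus W.
Proof.
(* [B] and [C] are identity matrices, with rows and columns cut according to the two bracketings. *)
pose B : 'M[F]_(rdegree U + (rdegree V + rdegree W), _) :=
  block_mx (row_mx 1%:M 0) 0 (block_mx 0 1%:M 0 0) (col_mx 0 1%:M).
pose C : 'M[F]_(rdegree U + rdegree V + rdegree W, _) :=
  block_mx (col_mx 1%:M 0) (block_mx 0 0 1%:M 0) 0 (row_mx 0 1%:M).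
have simp := (mulmx_block, mul_mx_row, mul_col_mx, mul_row_col, mul_col_row,
  mul_row_block, mul_block_col, mulmx0, mul0mx, addr0, add0r, mulmx1, mul1mx,
  row_mx0, col_mx0, add_block_mx).
apply: (@mx_rsim_rinv _ _ _ _ B C) => /=; first exact: addnA.
  have e : row_mx 0 (col_mx 0 1%:M) = block_mx 0 0 0 1%:M
      :> 'M[F]_(rdegree V + rdegree W, rdegree V + _).
    by rewrite block_mxEh col_mx0.
  by rewrite !simp e !simp !scalar_mx_block.
by move=> x Gx; rewrite !simp.
Qed.

Lemma dadd0_rsim U : grepr0 \oplus U \cong U.
Proof.
apply/mx_rsim_sym.
apply: (@mx_rsim_rinv _ _ _ _ (row_mx 0 1%:M) (col_mx 0 1%:M)) => //=.
  by rewrite mul_row_col mul0mx add0r mulmx1.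
move=> x Gx; rewrite mul_row_block mul_mx_row !mulmx0 !mul0mx !add0r.
by rewrite mulmx1 mul1mx.
Qed.

Lemma tensor0_rsim U : grepr0 \otimes U \cong grepr0.
Proof.
apply: (@mx_rsim_rinv _ _ _ _ (0 : 'M_(0, 0)) (0 : 'M_(0, 0))) => //=.
  by apply/matrixP => [[]].
by move=> x _; apply/matrixP => [[]].
Qed.

Lemma tensor_dadd_rsim U V W :
  (U \oplus V) \otimes W \cong U \otimes W \oplus V \otimes W.
Proof.
apply/mx_rsim_sym.
(* The two inclusions into [U \oplus V], tensored with the identity of [W]; the inverse is made of
   the projections. *)
apply: (@mx_rsim_rinv _ _ _ _
  (col_mx (tprod (row_mx 1%:M 0) 1%:M) (tprod (row_mx 0 1%:M) 1%:M))
  (row_mx (tprod (col_mx 1%:M 0) 1%:M) (tprod (col_mx 0 1%:M) 1%:M))) => /=.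
- by rewrite mulnDl.
- rewrite mul_col_row -!tprodE !mul_row_col !mulmx1 !mulmx0 ?mul0mx.
  by rewrite !addr0 !add0r !tprod0l !tprod1 -scalar_mx_block.
move=> x Gx; rewrite mul_block_col mul_col_mx !mul0mx addr0 add0r -!tprodE.
rewrite !mul_row_block !mul_mx_row.
by rewrite !mulmx0 !mul0mx !addr0 !add0r !mulmx1 !mul1mx.
Qed.

Section BigSum.

Notation bigsum s V := (\big[@dadd_grepr _ _ _ / grepr0]_(i <- s) V i).

Lemma big_dadd_rsim I (s : seq I) (V W : I -> representation F G) :
  (forall i, V i \cong W i) -> bigsum s V \cong bigsum s W.
Proof.
move=> VW; elim/big_rec2: _ => [|i X Y _ XY]; first exact: mx_rsim_refl.
exact: dadd_rsim.
Qed.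

Lemma big_dadd_rsim_in (I : eqType) (s : seq I)
    (V W : I -> representation F G) :
  {in s, forall i, V i \cong W i} -> bigsum s V \cong bigsum s W.
Proof.
elim: s => [|i s IHs] VW; first by rewrite !big_nil; apply: mx_rsim_refl.
rewrite !big_cons; apply: dadd_rsim; first by apply: VW; apply: mem_head.
by apply: IHs => j js; apply: VW; rewrite inE js orbT.
Qed.

Lemma big_dadd_cat I (s t : seq I) (V : I -> representation F G) :
  bigsum (s ++ t) V \cong bigsum s V \oplus bigsum t V.
Proof.
elim: s => [|i s IHs].
  by rewrite big_nil; apply/mx_rsim_sym/dadd0_rsim.
rewrite !big_cons; apply: mx_rsim_trans; last exact: dadd_rsimA.
exact: dadd_rsim (mx_rsim_refl _) IHs.
Qed.

Lemma big_dadd_flatten I J (s : seq I) (t : I -> seq J)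
    (V : J -> representation F G) :
  bigsum (flatten (map t s)) V \cong bigsum s (fun i => bigsum (t i) V).
Proof.
elim: s => [|i s IHs]; first by rewrite !big_nil; apply: mx_rsim_refl.
rewrite big_cons; apply: mx_rsim_trans (big_dadd_cat _ _ _) _.
exact: dadd_rsim (mx_rsim_refl _) IHs.
Qed.

(** A permutation is generated by exchanges of adjacent blocks, and each exchange is [dadd_rsimC] on
    the first two of three summands. *)
Lemma big_dadd_perm (I : eqType) (s t : seq I) (V : I -> representation F G) :
  perm_eq s t -> bigsum s V \cong bigsum t V.
Proof.
have cat3 s1 s2 s3 : bigsum (s1 ++ s2 ++ s3) V
    \cong bigsum s1 V \oplus bigsum s2 V \oplus bigsum s3 V.
  apply: mx_rsim_trans (big_dadd_cat _ _ _) _.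
  apply: mx_rsim_trans; last exact: dadd_rsimA.
  exact: dadd_rsim (mx_rsim_refl _) (big_dadd_cat _ _ _).
move=> st; pose P u := bigsum s V \cong bigsum u V.
suff stepP s1 s2 s3 : P (s1 ++ s2 ++ s3) -> P (s2 ++ s1 ++ s3).
  by apply: (catCA_perm_ind stepP st); apply: mx_rsim_refl.
move=> /mx_rsim_trans; apply.
apply: mx_rsim_trans (cat3 _ _ _) _.
apply: mx_rsim_trans; last exact/mx_rsim_sym/cat3.
exact: dadd_rsim (dadd_rsimC _ _) (mx_rsim_refl _).
Qed.

Lemma tensor_big_dadd I (s : seq I) (V : I -> representation F G) W :
  bigsum s V \otimes W \cong bigsum s (fun i => V i \otimes W).
Proof.
elim: s => [|i s IHs]; first by rewrite !big_nil; apply: tensor0_rsim.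
rewrite !big_cons; apply: mx_rsim_trans (tensor_dadd_rsim _ _ _) _.
exact: dadd_rsim (mx_rsim_refl _) IHs.
Qed.

Lemma muln_grepr_nseq I (i : I) k (V : I -> representation F G) :
  muln_grepr (V i) k = bigsum (nseq k i) V.
Proof. by rewrite /muln_grepr big_const_ord big_nseq. Qed.

End BigSum.

End Similarity.

(** * Clebsch-Gordan decompositions for two and three factors *)

Section ClebschGordan.

Variables (p : nat) (F : fieldType) (iota : {rmorphism 'F_p -> F}).
Hypothesis p_pr : prime p.

Notation V := (sym_repr iota).
Notation bigsum s V := (\big[@dadd_grepr _ _ _ / grepr0]_(i <- s) V i).

Lemma natr_fact_neq0 n : (n < p)%N -> n`!%:R != 0 :> F.
Proof.
have pF : p \in [pchar F] by rewrite (fmorph_pchar iota) pchar_Fp.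
rewrite -(dvdn_pcharf pF); elim: n => [|n IHn] np; first by rewrite Euclid_dvd1.
by rewrite factS Euclid_dvdM // negb_or gtnNdvd // IHn // ltnW.
Qed.

Lemma det_iota_SL2 g : g \in SL2 p -> \det (map_mx iota (GLval g)) = 1.
Proof. by rewrite inE det_map_mx => /eqP ->; rewrite rmorph1. Qed.

Lemma sym_tensor_top_rsim a b : (a + b < p)%N -> (a * b = 0)%N ->
  V a \otimes V b \cong V (a + b)%N.
Proof.
move=> abp ab0; apply: (@mx_rsim_inj _ _ _ _ _ _ _ (mult_mx F a b)) => /=.
- by rewrite mulSn mulnS ab0 addn0 addSn addnC.
- move=> v v0; apply: (mult_transvectant_inj (natr_fact_neq0 abp) v0).
  (* The transvectant has a * b = 0 rows, so it vanishes trivially and multiplication alone is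
     injective. *)
  by apply/colP => i; have := ltn_ord i; rewrite {2}ab0.
by move=> g _; rewrite mult_mx_sym.
Qed.

Lemma sym_tensor_rec_rsim a b : (a.+1 + b.+1 < p)%N ->
  V a.+1 \otimes V b.+1 \cong V (a.+1 + b.+1)%N \oplus V a \otimes V b.
Proof.
move=> abp.
apply: (@mx_rsim_inj _ _ _ _ _ _ _
  (col_mx (mult_mx F a.+1 b.+1) (transvectant F a.+1 b.+1))) => /=.
(* Dimensions: (a + 2)(b + 2) = (a + b + 3) + (a + 1)(b + 1). *)
- by lia.
- move=> v; rewrite mul_col_mx -[0]vsubmxK => /eq_col_mx[v0 v1].
  apply: (mult_transvectant_inj (natr_fact_neq0 abp)).
    by rewrite v0 linear0.
  by rewrite v1 linear0.
move=> g Gg; rewrite mul_col_mx mul_block_col !mul0mx addr0 add0r.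
by rewrite mult_mx_sym transvectant_sym ?det_iota_SL2.
Qed.

Lemma clebsch_gordan a b : (a + b < p)%N ->
  V a \otimes V b \cong
    bigsum (index_iota 0 (minn a b).+1) (fun i => V (a + b - 2 * i)%N).
Proof.
elim: a b => [|a IHa] [|b] abp.
1-3: rewrite ?minn0 ?min0n big_cons big_nil muln0 subn0.
1-3: apply: mx_rsim_trans (mx_rsim_sym (dadd0_rsim _)) _.
1-3: apply: mx_rsim_trans (dadd_rsimC _ _) (dadd_rsim _ (mx_rsim_refl _)).
1-3: by apply: sym_tensor_top_rsim; rewrite ?muln0 ?mul0n.
apply: mx_rsim_trans (sym_tensor_rec_rsim abp) _.
rewrite minnSS big_nat_recl // muln0 subn0.
apply: dadd_rsim (mx_rsim_refl _) _.
have abp' : (a + b < p)%N by lia.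
apply: mx_rsim_trans (IHa _ abp') _.
apply: big_dadd_rsim => i.
rewrite (_ : a.+1 + b.+1 - 2 * i.+1 = a + b - 2 * i)%N; last by lia.
exact: mx_rsim_refl.
Qed.

Lemma sym_tensor3_rsim r1 r2 r3 : (r2 <= r1)%N -> (r1 + r2 + r3 < p)%N ->
  V r1 \otimes V r2 \otimes V r3 \cong
    bigsum (flatten [seq [seq (i + j)%N
                         | i <- index_iota 0 (minn (r1 + r2 - 2 * j) r3).+1]
                    | j <- index_iota 0 r2.+1])
           (fun k => V (r1 + r2 + r3 - 2 * k)%N).
Proof.
move=> r21 rp; have r12p : (r1 + r2 < p)%N by lia.
apply: mx_rsim_trans (mx_rsim_sym (big_dadd_flatten _ _ _)).
apply: mx_rsim_trans (tensor_rsim (clebsch_gordan r12p) (mx_rsim_refl _)) _.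
rewrite (minn_idPr r21); apply: mx_rsim_trans (tensor_big_dadd _ _ _) _.
apply: big_dadd_rsim_in => j; rewrite mem_index_iota ltnS => /andP[_ jr2].
have jp : (r1 + r2 - 2 * j + r3 < p)%N by lia.
apply: mx_rsim_trans (clebsch_gordan jp) _; rewrite big_map.
apply: big_dadd_rsim => i.
rewrite (_ : r1 + r2 + r3 - 2 * (i + j) = r1 + r2 - 2 * j + r3 - 2 * i)%N.
  exact: mx_rsim_refl.
by lia.
Qed.

Lemma bigsum_muln_rsim m n (d : nat -> nat)
    (W : nat -> representation F (SL2 p)) :
  bigsum (flatten [seq nseq (d i) i | i <- index_iota m n]) W
    \cong bigsum (index_iota m n) (fun i => muln_grepr (W i) (d i)).
Proof.
apply: mx_rsim_trans (big_dadd_flatten _ _ _) _.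
apply: big_dadd_rsim => i; rewrite -muln_grepr_nseq; exact: mx_rsim_refl.
Qed.

End ClebschGordan.

(** * Counting the multiplicity of each index *)

Lemma perm_count_mem (T : eqType) (s t : seq T) :
  (forall x, count_mem x s = count_mem x t) -> perm_eq s t.
Proof. by move=> st; apply/allP => x _; apply/eqP/st. Qed.

Lemma count_flatten_nseq (d : nat -> nat) m n k :
  count_mem k (flatten [seq nseq (d i) i | i <- index_iota m n])
    = if (m <= k < n)%N then d k else 0%N.
Proof.
rewrite count_flatten -map_comp sumnE big_map.
rewrite (eq_bigr (fun i => if i == k then d i else 0%N)); last first.
  by move=> i _; rewrite /= count_nseq /=; case: eqP; rewrite ?mul1n.
by rewrite -big_mkcond /= big_nat1_eq.
Qed.

Lemma sum_nat_interval n l u :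
  (\sum_(0 <= j < n) (l <= j < u) = minn n u - l)%N.
Proof.
elim: n => [|n IHn]; first by rewrite big_geq // min0n.
rewrite big_nat_recr //= IHn; lia.
Qed.

Lemma count_shift j m k :
  count_mem k [seq (i + j)%N | i <- index_iota 0 m] = (j <= k < j + m)%N.
Proof.
rewrite (eq_map (fun i => addnC i j)) -iotaDl subn0 addn0.
by rewrite count_uniq_mem ?iota_uniq // mem_iota.
Qed.

(** The index k arises once for each j <= r2 with j <= k <= j + min(r1 + r2 - 2j, r3), that is, k -
    r3 <= j <= min(k, r1 + r2 - k). The truncated subtractions give 0 when no such j exists. *)
Lemma count_tensor3 r1 r2 r3 k : (r2 <= r1)%N ->
  count_mem k (flatten [seq [seq (i + j)%N
                         | i <- index_iota 0 (minn (r1 + r2 - 2 * j) r3).+1]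
                    | j <- index_iota 0 r2.+1])
  = (minn r2.+1 (minn k.+1 ((r1 + r2).+1 - k)) - (k - r3))%N.
Proof.
move=> r21; rewrite count_flatten -map_comp sumnE big_map -sum_nat_interval.
apply: eq_big_nat => j /andP[_ jr2].
by apply: etrans (count_shift _ _ _) _; congr (nat_of_bool _); lia.
Qed.

Local Close Scope ring_scope.
Local Open Scope grepr_scope.

Theorem corollary4p2 (p : nat) (F : closedFieldType)
    (iota : {rmorphism 'F_p -> F}) (r1 r2 r3 : nat) :
  prime p -> integralRange iota ->
  (r3 <= r2)%N -> (r2 <= r1)%N -> (r1 < p - r2 - r3)%N ->
  let V := sym_repr iota in
  let W := fun i : nat => V (r1 + r2 + r3 - 2 * i)%N in
  ((r2 + r3 <= r1)%N ->
     V r1 \otimes V r2 \otimes V r3 \cong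
       \bigoplus_(0 <= i < r3.+1) ((i + 1) \copies W i)
       \oplus \bigoplus_(r3.+1 <= i < r2.+1) ((r3 + 1) \copies W i)
       \oplus \bigoplus_(r2.+1 <= i < (r2 + r3).+1)
                ((r3 + r2 + 1 - i) \copies W i)) /\
  ((r1 < r2 + r3)%N ->
     V r1 \otimes V r2 \otimes V r3 \cong
       \bigoplus_(0 <= i < r3.+1) ((i + 1) \copies W i)
       \oplus \bigoplus_(r3.+1 <= i < r2.+1) ((r3 + 1) \copies W i)
       \oplus \bigoplus_(r2.+1 <= i < r1.+1)
                ((r3 + r2 + 1 - i) \copies W i)
       \oplus \bigoplus_(r1.+1 <= i < ((r1 + r2 + r3) %/ 2).+1)
                ((r1 + r2 + r3 - 2 * i + 1) \copies W i)).
Proof.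
move=> p_pr _ r32 r21 rp V W.
have lt_p : (r1 + r2 + r3 < p)%N by lia.
have rsim3 := sym_tensor3_rsim iota p_pr r21 lt_p.
pose S m n d := flatten [seq nseq (d i) i | i <- index_iota m n].
have rsimS m n d : \big[@dadd_grepr _ _ _ / grepr0]_(i <- S m n d) W i
    \cong \bigoplus_(m <= i < n) ((d i) \copies W i).
  exact: bigsum_muln_rsim.
have rsim_cat s t (X Y : representation F (SL2 p)) :
    \big[@dadd_grepr _ _ _ / grepr0]_(i <- s) W i \cong X ->
    \big[@dadd_grepr _ _ _ / grepr0]_(i <- t) W i \cong Y ->
  \big[@dadd_grepr _ _ _ / grepr0]_(i <- s ++ t) W i \cong X \oplus Y.
  by move=> sX tY; apply: mx_rsim_trans (big_dadd_cat _ _ _) (dadd_rsim sX tY).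
split=> r123; apply: mx_rsim_trans rsim3 _.
  (* The right-hand side, peeled from its last summand, determines the list of indices it sums over,
     a concatenation of lists [S]. *)
  apply: mx_rsim_trans; last first.
    by do 2![apply: (rsim_cat); last exact: rsimS]; apply: rsimS.
  apply: big_dadd_perm; apply: perm_count_mem => k.
  rewrite count_tensor3 // 2!count_cat !count_flatten_nseq.
  (* As k <= r2 + r3 <= r1 in all ranges, the bound r1 + r2 - k on j is at least r2 and never
     active. *)
  by do 3?[case: ifP => ?]; lia.
apply: mx_rsim_trans; last first.
  by do 3![apply: (rsim_cat); last exact: rsimS]; apply: rsimS.
apply: big_dadd_perm; apply: perm_count_mem => k.
rewrite count_tensor3 // 3!count_cat !count_flatten_nseq.
(* For k > r1 the upper bound on j is r1 + r2 - k, giving r1 + r2 + r3 - 2k + 1 values until this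
   reaches 0. *)
by do 4?[case: ifP => ?]; lia.
Qed.
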